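(* Suppose $F$ is a $\mu$-PL function for some $\mu>0$, let $\kappa=L/\mu$ and assume $\kappa>n^{1/3}$ and that $n^{2/3}$ is an integer. Let $b=n^{2/3}$, $\eta=1/(5L)$, $m=\lfloor n^{1/3}\rfloor$ and $T=\lceil 30\kappa\rceil$. Then for every integer $K\ge1$, both the output $x^K$ of PL-SVRG$(x^0,K,T,m,b,\eta)$ and the output $x^K$ of PL-SAGA$(x^0,K,T,b,\eta)$ satisfy $$\mathbb E\big[F(x^K)-F(x^* )\big]\le \frac{F(x^0)-F(x^* )}{2^K},$$ where $x^*$ is an optimal solution of $\min_x F(x)$.
   Context: Setting: Let $n,d\ge 1$ be integers and $[n]=\{1,\dots,n\}$. Let $f_1,\dots,f_n:\mathbb R^d\to\mathbb R$ be differentiable (possibly nonconvex) functions, each $L$-smooth for some $L>0$, i.e. $\|\nabla f_i(x)-\nabla f_i(y)\|\le L\|x-y\|$ for all $x,y\in\mathbb R^d$ and $i\in[n]$. Let $f=\frac1n\sum_{i=1}^n f_i$. Let $h:\mathbb R^d\to\mathbb R\cup\{+\infty\}$ be proper, lower semicontinuous and convex, with closed domain. Let $F=f+h$, and let $x^*$ be a global minimizer of $F$ on $\mathbb R^d$ (assumed to exist). For $\eta>0$, $\mathrm{prox}_{\eta h}(x):=\arg\min_{y\in\mathbb R^d}\big(h(y)+\frac1{2\eta}\|y-x\|^2\big)$. $\mu$-PL functions: for $x\in\mathbb R^d$ and $\alpha>0$ define $D_h(x,\alpha):=-2\alpha\min_{y\in\mathbb R^d}\big[\langle\nabla f(x),y-x\rangle+\frac{\alpha}{2}\|y-x\|^2+h(y)-h(x)\big]$.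 $F$ is called $\mu$-PL ($\mu>0$) if $\mu\,(F(x)-F(x^* ))\le \frac12 D_h(x,\mu)$ for all $x\in\mathrm{dom}(h)$. Algorithm ProxSVRG$(x^0,T,m,b,\eta)$: Given $x^0\in\mathbb R^d$, positive integers $T,m,b$ and $\eta>0$, let $S=\lceil T/m\rceil$ and set $\tilde x^0=x^0_m=x^0$. For $s=0,\dots,S-1$: set $x^{s+1}_0=x^s_m$ and $g^{s+1}=\frac1n\sum_{i=1}^n\nabla f_i(\tilde x^s)$; for $t=0,\dots,m-1$: draw a multiset $I_t$ of $b$ indices, each drawn independently and uniformly at random from $[n]$ (with replacement, independently of all previous draws), set $v^{s+1}_t=\frac1b\sum_{i\in I_t}\big(\nabla f_i(x^{s+1}_t)-\nabla f_i(\tilde x^s)\big)+g^{s+1}$ and $x^{s+1}_{t+1}=\mathrm{prox}_{\eta h}(x^{s+1}_t-\eta v^{s+1}_t)$; after the inner loop set $\tilde x^{s+1}=x^{s+1}_m$. The output $x_a$ is chosen uniformly at random from $\{x^{s+1}_t: 0\le t\le m-1,\ 0\le s\le S-1\}$. Algorithm ProxSAGA$(x^0,T,b,\eta)$: Given $x^0\in\mathbb R^d$, positive integers $T,b$ and $\eta>0$, set $\alpha^0_i=x^0$ for all $i\in[n]$. For $t=0,1,\dots$ let $g^t=\frac1n\sum_{i=1}^n\nabla f_i(\alpha^t_i)$. For $t=0,\dots,T-1$: draw two multisets $I_t,J_t$, each consisting of $b$ indices drawn independently and uniformly at random from $[n]$ (with replacement; $I_t$, $J_t$ independent of each other and of all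 previous draws); set $v^t=\frac1b\sum_{i\in I_t}\big(\nabla f_i(x^t)-\nabla f_i(\alpha^t_i)\big)+g^t$ and $x^{t+1}=\mathrm{prox}_{\eta h}(x^t-\eta v^t)$; set $\alpha^{t+1}_j=x^t$ for $j\in J_t$ and $\alpha^{t+1}_j=\alpha^t_j$ for $j\notin J_t$. The output $x_a$ is chosen uniformly at random from $\{x^0,\dots,x^{T-1}\}$. Algorithm PL-SVRG$(x^0,K,T,m,b,\eta)$: for $k=1,\dots,K$, let $x^k$ be the output $x_a$ of ProxSVRG$(x^{k-1},T,m,b,\eta)$ (run with fresh independent randomness); output $x^K$. Algorithm PL-SAGA$(x^0,K,T,b,\eta)$: for $k=1,\dots,K$, let $x^k$ be the output $x_a$ of ProxSAGA$(x^{k-1},T,b,\eta)$ (run with fresh independent randomness); output $x^K$. Expectations are over all randomness. *)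

(* Defs.v *)
From mathcomp Require Import ssreflect ssrfun ssrbool eqtype ssrnat seq fintype bigop.
From Stdlib Require Import Reals.
Set Implicit Arguments. Unset Strict Implicit. Unset Printing Implicit Defensive.
Local Open Scope R_scope.

Definition vec (d : nat) := 'I_d -> R.
Definition vadd d (x y : vec d) : vec d := fun j => x j + y j.
Definition vsub d (x y : vec d) : vec d := fun j => x j - y j.
Definition vscale d (a : R) (x : vec d) : vec d := fun j => a * x j.
Definition vzero d : vec d := fun _ => 0.
Definition dot d (x y : vec d) : R := \big[Rplus/0]_(j < d) (x j * y j).
Definition vnorm d (x : vec d) : R := sqrt (dot x x).

Definition vsum_list d (l : seq (vec d)) : vec d := foldr (@vadd d) (@vzero d) l.

Definition has_gradient d (f : vec d -> R) (g : vec d -> vec d) : Prop :=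
  forall x eps, 0 < eps -> exists delta, 0 < delta /\
    forall y, vnorm (vsub y x) < delta ->
      Rabs (f y - f x - dot (g x) (vsub y x)) <= eps * vnorm (vsub y x).

Definition lipschitz_grad d (L : R) (g : vec d -> vec d) : Prop :=
  forall x y, vnorm (vsub (g x) (g y)) <= L * vnorm (vsub x y).

(* ---------- extended-valued h : R^d -> R U {+oo} ----------
   h is represented by its domain domh and its (real) values hv on domh:
   h x = hv x if domh x, and h x = +oo otherwise. *)
Definition h_proper d (domh : vec d -> Prop) : Prop := exists x, domh x.

Definition h_convex d (domh : vec d -> Prop) (hv : vec d -> R) : Prop :=
  forall x y th, domh x -> domh y -> 0 <= th <= 1 ->
    domh (vadd (vscale th x) (vscale (1 - th) y)) /\
    hv (vadd (vscale th x) (vscale (1 - th) y)) <= th * hv x + (1 - th) * hv y.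

(* lower semicontinuity of the extended-valued h: for every M < h x
   (any real M if h x = +oo), h > M on a neighbourhood of x *)
Definition h_lsc d (domh : vec d -> Prop) (hv : vec d -> R) : Prop :=
  forall x M, (domh x -> M < hv x) ->
    exists delta, 0 < delta /\
      forall y, domh y -> vnorm (vsub y x) < delta -> M < hv y.

Definition closed_vset d (A : vec d -> Prop) : Prop :=
  forall x, (forall eps, 0 < eps -> exists y, A y /\ vnorm (vsub y x) < eps) -> A x.

Definition is_prox d (domh : vec d -> Prop) (hv : vec d -> R) (eta : R)
    (x p : vec d) : Prop :=
  domh p /\
  forall y, domh y ->
    hv p + (vnorm (vsub p x))^2 / (2 * eta) <= hv y + (vnorm (vsub y x))^2 / (2 * eta).

Definition avg_ord (k : nat) (G : 'I_k -> R) : R := / INR k * \big[Rplus/0]_(i < k) G i.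

Definition fsum n d (f : 'I_n -> vec d -> R) (x : vec d) : R := avg_ord (fun i => f i x).

Definition gradsum n d (grad : 'I_n -> vec d -> vec d) (x : vec d) : vec d :=
  fun j => avg_ord (fun i => grad i x j).

(* F = f + h, on dom h (F = +oo outside dom h) *)
Definition Fobj n d (f : 'I_n -> vec d -> R) (hv : vec d -> R) (x : vec d) : R :=
  fsum f x + hv x.

(* D_h(x, alpha) = -2 alpha min_y [<grad f x, y - x> + alpha/2 ||y-x||^2 + h y - h x],
   given relationally: Dh_is ... D  means D is that value (the min is over
   y in dom h since h = +oo outside). *)
Definition Dh_is n d (grad : 'I_n -> vec d -> vec d) (domh : vec d -> Prop)
    (hv : vec d -> R) (x : vec d) (alpha D : R) : Prop :=
  let phi := fun y => dot (gradsum grad x) (vsub y x)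
                      + alpha / 2 * (vnorm (vsub y x))^2 + hv y - hv x in
  exists M, ((exists y, domh y /\ phi y = M) /\ (forall y, domh y -> M <= phi y))
            /\ D = - 2 * alpha * M.

Definition is_PL n d (f : 'I_n -> vec d -> R) (grad : 'I_n -> vec d -> vec d)
    (domh : vec d -> Prop) (hv : vec d -> R) (xs : vec d) (mu : R) : Prop :=
  forall x, domh x -> forall D, Dh_is grad domh hv x mu D ->
    mu * (Fobj f hv x - Fobj f hv xs) <= D / 2.

(* Eseq n N G = E[G(w)] where w is a list of N i.i.d. uniform indices of [n] *)
Fixpoint Eseq (n N : nat) (G : seq 'I_n -> R) : R :=
  match N with
  | O => G [::]
  | S N' => avg_ord (fun i : 'I_n => Eseq N' (fun w => G (i :: w)))
  end.

Definition ceil_div (T m : nat) : nat := Nat.div (T + m - 1) m.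

Section Algos.
Variables (n d : nat) (grad : 'I_n -> vec d -> vec d) (prox : R -> vec d -> vec d).

Definition vr_est (b : nat) (I : seq 'I_n) (x y g : vec d) : vec d :=
  vadd (vscale (/ INR b) (vsum_list [seq vsub (grad i x) (grad i y) | i <- I])) g.

(* r inner iterations from x with snapshot xt and full gradient g, consuming
   b draws per iteration; returns (iterates x_0..x_{r-1}, x_r, remaining draws) *)
Fixpoint svrg_inner (b r : nat) (eta : R) (xt g x : vec d) (w : seq 'I_n)
  : seq (vec d) * vec d * seq 'I_n :=
  match r with
  | O => ([::], x, w)
  | S r' =>
      let v := vr_est b (take b w) x xt g in
      let x' := prox eta (vsub x (vscale eta v)) in
      let: (l, xl, w') := svrg_inner b r' eta xt g x' (drop b w) in
      (x :: l, xl, w')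
  end.

Fixpoint svrg_outer (b m s : nat) (eta : R) (x : vec d) (w : seq 'I_n) : seq (vec d) :=
  match s with
  | O => [::]
  | S s' =>
      let: (l, xm, w') := svrg_inner b m eta x (gradsum grad x) x w in
      l ++ svrg_outer b m s' eta xm w'
  end.

Definition E_ProxSVRG (T m b : nat) (eta : R) (x0 : vec d) (G : vec d -> R) : R :=
  let S := ceil_div T m in
  @Eseq n (S * m * b)%nat
    (fun w => avg_ord (fun k : 'I_(S * m)%nat => G (nth x0 (svrg_outer b m S eta x0 w) k))).

Fixpoint saga_run (b r : nat) (eta : R) (x : vec d) (alpha : 'I_n -> vec d)
    (w : seq 'I_n) : seq (vec d) :=
  match r with
  | O => [::]
  | S r' =>
      let I := take b w in
      let J := take b (drop b w) in
      let g := fun j => avg_ord (fun i => grad i (alpha i) j) in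
      let v := vadd (vscale (/ INR b)
                  (vsum_list [seq vsub (grad i x) (grad i (alpha i)) | i <- I])) g in
      let x' := prox eta (vsub x (vscale eta v)) in
      let alpha' := fun j => if j \in J then x else alpha j in
      x :: saga_run b r' eta x' alpha' (drop (b + b)%nat w)
  end.

Definition E_ProxSAGA (T b : nat) (eta : R) (x0 : vec d) (G : vec d -> R) : R :=
  @Eseq n (T * (b + b))%nat
    (fun w => avg_ord (fun k : 'I_T => G (nth x0 (saga_run b T eta x0 (fun _ => x0) w) k))).

End Algos.

(* Restarting scheme with fresh independent randomness at each stage:
   iterE E K x0 G = E[G(x^K)], where x^k is the output of the stage run from
   x^{k-1}, and E x G is the expectation of G(stage output from x). *)
Fixpoint iterE d (E : vec d -> (vec d -> R) -> R) (K : nat) (x : vec d) (G : vec d -> R) : R :=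
  match K with
  | O => G x
  | S K' => E x (fun y => iterE E K' y G)
  end.

(* Main.v *)
(* Write Delta = F - F xs.  One proximal step p from x along an estimate v satisfies, pathwise,
     Delta p <= (1 - eta mu) Delta x + (eta/2) |v - grad f x|^2 - (1/(2 eta) - L/2) |p - x|^2:
   compare p, through the three-point inequality of the prox, with the point z obtained by moving
   the fraction eta mu from x towards the minimizer in D_h(x, mu); the PL inequality makes the
   model at z smaller than its value at x by eta mu Delta x.  The variance of v is at most L^2/b
   times the mean squared distance from x to the reference points, and a Lyapunov function
   Delta plus c times that mean squared distance absorbs it into the term -2L |p - x|^2.  Telescoping
   gives E Delta(x_a) <= Delta(x^0) / (eta mu T) = 5 kappa Delta(x^0) / T <= Delta(x^0) / 2
   for each stage. *)
Require Import Defs.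
From HB Require Import structures.
From mathcomp Require Import ssreflect ssrfun ssrbool eqtype ssrnat seq fintype bigop.
From Stdlib Require Import Reals Lra.
Set Implicit Arguments. Unset Strict Implicit. Unset Printing Implicit Defensive.
Local Open Scope R_scope.

(** * Finite real sums and uniform averages *)

#[warnings="-redundant-canonical-projection"]
HB.instance Definition _ := Monoid.isComLaw.Build R 0 Rplus
  (fun x y z => esym (Rplus_assoc x y z)) Rplus_comm Rplus_0_l.
#[warnings="-redundant-canonical-projection"]
HB.instance Definition _ := Monoid.isMulLaw.Build R 0 Rmult Rmult_0_l Rmult_0_r.
#[warnings="-redundant-canonical-projection"]
HB.instance Definition _ := Monoid.isAddLaw.Build R Rmult Rplus
  Rmult_plus_distr_r Rmult_plus_distr_l.

Lemma sumR_le (I : Type) (r : seq I) (F G : I -> R) :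
  (forall i, F i <= G i) ->
  \big[Rplus/0]_(i <- r) F i <= \big[Rplus/0]_(i <- r) G i.
Proof.
move=> FG; elim: r => [|i r IH]; first by rewrite !big_nil; apply: Rle_refl.
by rewrite !big_cons; apply: Rplus_le_compat.
Qed.

Lemma sumR_const (k : nat) (c : R) : \big[Rplus/0]_(i < k) c = INR k * c.
Proof.
elim: k => [|k IH]; first by rewrite big_ord0 /=; ring.
by rewrite big_ord_recl IH S_INR; ring.
Qed.

Section Average.
Variable k : nat.
Hypothesis k_gt0 : (0 < k)%nat.
Implicit Types F G : 'I_k -> R.

Lemma INR_gt0 : 0 < INR k.
Proof. by apply: lt_0_INR; apply/ltP. Qed.

Lemma eq_avg F G : (forall i, F i = G i) -> avg_ord F = avg_ord G.
Proof. by move=> FG; rewrite /avg_ord (eq_bigr G). Qed.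

Lemma avg_le F G : (forall i, F i <= G i) -> avg_ord F <= avg_ord G.
Proof.
move=> FG; apply: Rmult_le_compat_l; last exact: sumR_le.
exact/Rlt_le/Rinv_0_lt_compat/INR_gt0.
Qed.

Lemma avgD F G : avg_ord (fun i => F i + G i) = avg_ord F + avg_ord G.
Proof. by rewrite /avg_ord big_split /=; ring. Qed.

Lemma avgZ a F : avg_ord (fun i => a * F i) = a * avg_ord F.
Proof. by rewrite /avg_ord -big_distrr /=; ring. Qed.

Lemma avg_const a : avg_ord (fun _ : 'I_k => a) = a.
Proof. by rewrite /avg_ord sumR_const; field; have := INR_gt0; lra. Qed.

Lemma avg_ge0 F : (forall i, 0 <= F i) -> 0 <= avg_ord F.
Proof. by move=> F0; rewrite -(avg_const 0); apply: avg_le. Qed.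

Lemma avg_delta (j : 'I_k) a c :
  avg_ord (fun i => if j == i then a else c) = c + (a - c) / INR k.
Proof.
rewrite /avg_ord (bigD1 j) //= eqxx.
rewrite (eq_bigr (fun _ => c)) => [|i]; last by rewrite eq_sym => /negPf ->.
have -> : \big[Rplus/0]_(i < k | i != j) c = (INR k - 1) * c.
  have := sumR_const k c; rewrite (bigD1 j) //= => E;
  apply: (Rplus_eq_reg_l c); apply: (eq_trans E); ring.
by field; have := INR_gt0; lra.
Qed.

Lemma avg_sum_exchange (I : finType) (H : 'I_k -> I -> R) :
  avg_ord (fun i => \big[Rplus/0]_j H i j) = \big[Rplus/0]_j avg_ord (H^~ j).
Proof. by rewrite /avg_ord exchange_big /= big_distrr. Qed.

End Average.

(** * Expectation over independent uniform draws *)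

Section Draws.
Variable n : nat.
Hypothesis n_gt0 : (0 < n)%nat.
Implicit Types G H : seq 'I_n -> R.

Lemma eq_Eseq N G H :
  (forall w, size w = N -> G w = H w) -> Eseq N G = Eseq N H.
Proof.
elim: N G H => [|N IH] G H GH /=; first exact: GH.
by apply: eq_avg => i; apply: IH => w sw; apply: GH; rewrite /= sw.
Qed.

Lemma Eseq_le N G H :
  (forall w, size w = N -> G w <= H w) -> Eseq N G <= Eseq N H.
Proof.
elim: N G H => [|N IH] G H GH /=; first exact: GH.
by apply: avg_le => // i; apply: IH => w sw; apply: GH; rewrite /= sw.
Qed.

Lemma EseqD N G H : Eseq N (fun w => G w + H w) = Eseq N G + Eseq N H.
Proof.
elim: N G H => [|N IH] G H //=.
by rewrite -avgD; apply: eq_avg => i; rewrite IH.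
Qed.

Lemma EseqZ N a G : Eseq N (fun w => a * G w) = a * Eseq N G.
Proof.
elim: N G => [|N IH] G //=.
by rewrite -avgZ; apply: eq_avg => i; rewrite IH.
Qed.

Lemma Eseq_const N a : Eseq N (fun _ : seq 'I_n => a) = a.
Proof.
elim: N => [|N IH] //=.
by rewrite -[RHS](avg_const n_gt0); apply: eq_avg.
Qed.

Lemma Eseq_affine N a c G : Eseq N (fun w => a + c * G w) = a + c * Eseq N G.
Proof. by rewrite EseqD EseqZ Eseq_const. Qed.

(** Independence of successive blocks: a mini-batch can be fixed while the later draws are averaged
    out. *)
Lemma Eseq_cat N M G :
  Eseq (N + M)%nat G = Eseq N (fun u => Eseq M (fun w => G (u ++ w))).
Proof.
elim: N G => [|N IH] G //=.
by apply: eq_avg => i; rewrite IH.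
Qed.

Lemma Eseq_sum_exchange (I : finType) N (H : seq 'I_n -> I -> R) :
  Eseq N (fun w => \big[Rplus/0]_j H w j) = \big[Rplus/0]_j Eseq N (H^~ j).
Proof.
elim: N H => [|N IH] H //=.
by rewrite -avg_sum_exchange; apply: eq_avg => i; rewrite IH.
Qed.

Lemma Eseq_avg_exchange N (H : seq 'I_n -> 'I_n -> R) :
  Eseq N (fun w => avg_ord (H w)) = avg_ord (fun i => Eseq N (H^~ i)).
Proof. by rewrite /avg_ord EseqZ Eseq_sum_exchange. Qed.

Lemma Eseq_sum_centered N (xi : 'I_n -> R) :
  avg_ord xi = 0 ->
  Eseq N (fun w => \big[Rplus/0]_(i <- w) xi i) = 0.
Proof.
move=> xi0; elim: N => [|N IH] /=; first by rewrite big_nil.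
rewrite -[RHS]xi0; apply: eq_avg => i.
rewrite (@eq_Eseq _ _ (fun w => xi i + \big[Rplus/0]_(j <- w) xi j)).
  by rewrite EseqD Eseq_const IH; ring.
by move=> w _; rewrite big_cons.
Qed.

(** Peeling off the first draw [i] and expanding the square leaves a cross term [2 * xi i] times a
    centered sum, whose mean is zero; hence variances add up. *)
Lemma Eseq_sum_centered_sqr N (xi : 'I_n -> R) :
  avg_ord xi = 0 ->
  Eseq N (fun w => (\big[Rplus/0]_(i <- w) xi i) ^ 2)
  = INR N * avg_ord (fun i => xi i ^ 2).
Proof.
move=> xi0; elim: N => [|N IH] /=; first by rewrite big_nil; ring.
rewrite -/(INR N.+1) S_INR Rmult_plus_distr_r Rmult_1_l Rplus_comm -IH.
rewrite -[X in _ + X](avg_const n_gt0) -avgD; apply: eq_avg => i.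
rewrite (@eq_Eseq _ _ (fun w => (xi i ^ 2 + (\big[Rplus/0]_(j <- w) xi j) ^ 2) +
    2 * xi i * \big[Rplus/0]_(j <- w) xi j)); last first.
  by move=> w _; rewrite big_cons /=; ring.
by rewrite EseqD EseqZ Eseq_sum_centered // EseqD Eseq_const; ring.
Qed.

Lemma avg_centered_sqr_le (xi : 'I_n -> R) :
  avg_ord (fun i => (xi i - avg_ord xi) ^ 2) <= avg_ord (fun i => xi i ^ 2).
Proof.
set a := avg_ord xi.
have -> : avg_ord (fun i => (xi i - a) ^ 2)
        = avg_ord (fun i => (xi i ^ 2 + (- 2 * a) * xi i) + a ^ 2).
  by apply: eq_avg => i; ring.
rewrite !avgD avgZ avg_const // -/a.
by have := pow2_ge_0 a; lra.
Qed.

(** After centering, the variance of a mean of [N] independent draws is [/ INR N] times that of one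
    draw, and a variance is at most the second moment. *)
Lemma Eseq_mean_sqr_le N (xi : 'I_n -> R) :
  (0 < N)%nat ->
  Eseq N (fun w => (/ INR N * (\big[Rplus/0]_(i <- w) xi i) - avg_ord xi) ^ 2)
  <= / INR N * avg_ord (fun i => xi i ^ 2).
Proof.
move=> N_gt0; have N0 := INR_gt0 N_gt0.
pose ze i := xi i - avg_ord xi.
have ze0 : avg_ord ze = 0.
  by rewrite /ze (avgD xi) avg_const //; ring.
have sum_ze w : \big[Rplus/0]_(i <- w) ze i
    = \big[Rplus/0]_(i <- w) xi i - INR (size w) * avg_ord xi.
  elim: w => [|i w IH]; first by rewrite !big_nil /=; ring.
  have -> : size (i :: w) = (size w).+1 by [].
  by rewrite !big_cons IH /ze S_INR; ring.
rewrite (@eq_Eseq _ _ (fun w => / INR N ^ 2 * (\big[Rplus/0]_(i <- w) ze i) ^ 2)).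
  rewrite EseqZ Eseq_sum_centered_sqr //.
  have -> : / INR N ^ 2 * (INR N * avg_ord (fun i => ze i ^ 2)) =
     / INR N * avg_ord (fun i => ze i ^ 2) by field; lra.
  apply: Rmult_le_compat_l; last exact: avg_centered_sqr_le.
  exact/Rlt_le/Rinv_0_lt_compat.
by move=> w sw; rewrite sum_ze sw; field; lra.
Qed.

(** The [N] draws all miss [j] with probability [(1 - / INR n) ^ N]. This is the law by which SAGA
    refreshes a stored point. *)
Lemma Eseq_mem (j : 'I_n) N a c :
  Eseq N (fun w => if j \in w then a else c) = a + (c - a) * (1 - / INR n) ^ N.
Proof.
elim: N => [|N IH] /=; first by ring.
set e := a + _ in IH.
rewrite (@eq_avg _ _ (fun i => if j == i then a else e)).
  by rewrite avg_delta // /e; field; have := INR_gt0 n_gt0; lra.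
move=> i; case: (eqVneq j i) => [->|ji].
  rewrite -[RHS](Eseq_const N); apply: eq_Eseq => w _.
  by rewrite inE eqxx.
by rewrite -IH; apply: eq_Eseq => w _; rewrite inE (negPf ji).
Qed.

End Draws.

(** * Inner product, norm and Young inequalities *)

Section Euclidean.
Variable d : nat.
Implicit Types x y z : vec d.

Lemma dotC x y : dot x y = dot y x.
Proof. by apply: eq_bigr => j _; apply: Rmult_comm. Qed.

Lemma dot_addl x y z : dot (vadd x y) z = dot x z + dot y z.
Proof. by rewrite /dot -big_split; apply: eq_bigr => j _; rewrite /vadd /=; ring. Qed.

Lemma dot_scalel a x z : dot (vscale a x) z = a * dot x z.
Proof. by rewrite /dot big_distrr; apply: eq_bigr => j _; rewrite /vscale /=; ring. Qed.

Lemma dot_subl x y z : dot (vsub x y) z = dot x z - dot y z.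
Proof.
have -> : dot x z - dot y z = dot x z + (-1) * dot y z by ring.
rewrite /dot big_distrr -big_split.
by apply: eq_bigr => j _; rewrite /vsub /=; ring.
Qed.

Lemma dot_addr x y z : dot z (vadd x y) = dot z x + dot z y.
Proof. by rewrite !(dotC z) dot_addl. Qed.

Lemma dot_scaler a x z : dot z (vscale a x) = a * dot z x.
Proof. by rewrite !(dotC z) dot_scalel. Qed.

Lemma dot_subr x y z : dot z (vsub x y) = dot z x - dot z y.
Proof. by rewrite !(dotC z) dot_subl. Qed.

Definition dotE := (dot_addl, dot_addr, dot_subl, dot_subr, dot_scalel, dot_scaler).

Lemma dot_ge0 x : 0 <= dot x x.
Proof.
rewrite /dot; elim/big_rec: _ => [|j r _ r0]; first exact: Rle_refl.
by have := Rle_0_sqr (x j); rewrite /Rsqr; lra.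
Qed.

Lemma vnorm_sqr x : vnorm x ^ 2 = dot x x.
Proof. by rewrite /vnorm pow2_sqrt //; apply: dot_ge0. Qed.

Lemma vnorm_ge0 x : 0 <= vnorm x.
Proof. exact: sqrt_pos. Qed.

Lemma vnorm_scale a x : vnorm (vscale a x) = Rabs a * vnorm x.
Proof.
rewrite /vnorm dot_scalel dot_scaler -Rmult_assoc sqrt_mult_alt.
  by rewrite -/(Rsqr a) sqrt_Rsqr_abs.
by have := Rle_0_sqr a.
Qed.

Lemma eq_vnorm x y : (forall j, x j = y j) -> vnorm x = vnorm y.
Proof. by move=> xy; rewrite /vnorm /dot; under eq_bigr => j _ do rewrite xy. Qed.

Lemma eq_dotr x y z : (forall j, x j = y j) -> dot z x = dot z y.
Proof. by move=> xy; rewrite /dot; under eq_bigr => j _ do rewrite xy. Qed.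

Lemma dot_young s x y : 0 < s -> dot x y <= s / 2 * dot x x + / (2 * s) * dot y y.
Proof.
move=> s0; have := dot_ge0 (vsub (vscale s x) y).
rewrite !dotE (dotC y x) => H.
have -> : s / 2 * dot x x + / (2 * s) * dot y y
  = dot x y + / (2 * s) * (s * (s * dot x x) - s * dot x y - (s * dot x y - dot y y)).
  by field; lra.
suff : 0 <= / (2 * s) * (s * (s * dot x x) - s * dot x y - (s * dot x y - dot y y)) by lra.
by apply: Rmult_le_pos; [apply/Rlt_le/Rinv_0_lt_compat; lra | lra].
Qed.

Lemma dot_add_young t x y : 0 < t ->
  dot (vadd x y) (vadd x y) <= (1 + / t) * dot x x + (1 + t) * dot y y.
Proof.
move=> t0; have it : 0 < / t by apply: Rinv_0_lt_compat.
have := @dot_young (/ t) x y it; rewrite !dotE (dotC y x).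
have -> : / (2 * / t) = t / 2 by field; lra.
by lra.
Qed.

End Euclidean.

(** * The quadratic upper bound for smooth functions *)

Section Descent.
Variables (d : nat) (f : vec d -> R) (g : vec d -> vec d).
Hypothesis fg : has_gradient f g.

Lemma derivable_along_line (x u : vec d) t :
  derivable_pt_lim (fun s => f (vadd x (vscale s u))) t
    (dot (g (vadd x (vscale t u))) u).
Proof.
move=> eps eps0.
have u0 := vnorm_ge0 u.
(* The [+ 1] covers [u = 0]; the factor 2 makes the final bound on the difference quotient
   strict. *)
have e0 : 0 < eps / (2 * (vnorm u + 1)) by apply: Rdiv_lt_0_compat; lra.
have [del [del0 H]] := fg (vadd x (vscale t u)) e0.
have del0' : 0 < del / (vnorm u + 1) by apply: Rdiv_lt_0_compat; lra.
exists (mkposreal _ del0') => h h0 /= hdel.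
have hE : forall j, vsub (vadd x (vscale (t + h) u)) (vadd x (vscale t u)) j = vscale h u j.
  by move=> j; rewrite /vsub /vadd /vscale; ring.
have hp : 0 < Rabs h by apply: Rabs_pos_lt.
have := H (vadd x (vscale (t + h) u)).
rewrite (eq_vnorm hE) (eq_dotr _ hE) vnorm_scale dot_scaler => {}H.
have hu : Rabs h * (vnorm u + 1) < del.
  have -> : del = del / (vnorm u + 1) * (vnorm u + 1) by field; lra.
  by apply: Rmult_lt_compat_r; lra.
have {}H := H ltac:(nra).
set q := _ / h - _.
have qE : f (vadd x (vscale (t + h) u)) - f (vadd x (vscale t u))
   - h * dot (g (vadd x (vscale t u))) u = h * q by rewrite /q; field.
rewrite qE Rabs_mult in H.
have key : eps / (2 * (vnorm u + 1)) * vnorm u < eps.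
  have -> : eps / (2 * (vnorm u + 1)) * vnorm u
    = eps * (vnorm u / (2 * (vnorm u + 1))) by field; lra.
  rewrite -[X in _ < X]Rmult_1_r; apply: Rmult_lt_compat_l => //.
  by apply: (Rmult_lt_reg_r (2 * (vnorm u + 1))); [lra | field_simplify; lra].
have {}H : Rabs q <= eps / (2 * (vnorm u + 1)) * vnorm u.
  by apply: (Rmult_le_reg_l (Rabs h)) => //; lra.
lra.
Qed.

(** Subtracting the linear and quadratic terms from [f] along the segment gives [psi], whose
    derivative is nonpositive for positive [t]; the mean value theorem on [0, 1] then yields
    [psi 1 <= psi 0]. *)
Lemma descent L x y : 0 < L -> lipschitz_grad L g ->
  f y <= f x + dot (g x) (vsub y x) + L / 2 * dot (vsub y x) (vsub y x).
Proof.
move=> L0 gL; set u := vsub y x.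
set G := fun t => dot (g (vadd x (vscale t u))) u.
have slope t : 0 < t -> G t - dot (g x) u <= L * t * dot u u.
  (* Young with weight [/ (t * L)] replaces Cauchy-Schwarz: since the gradient moves by at most
     [L * t * vnorm u], each half contributes at most [t * L / 2 * dot u u]. *)
  move=> t0; have tL : 0 < / (t * L) by apply: Rinv_0_lt_compat; nra.
  rewrite -dot_subl; apply: Rle_trans (dot_young _ _ tL) _.
  rewrite -!vnorm_sqr; have := gL (vadd x (vscale t u)) x.
  have -> : vnorm (vsub (vadd x (vscale t u)) x) = t * vnorm u.
    rewrite -[X in X * vnorm u](Rabs_pos_eq t); last by lra.
    by rewrite -vnorm_scale; apply: eq_vnorm => j; rewrite /vsub /vadd /vscale; ring.
  set w := vsub _ _ => wu.
  have : vnorm w ^ 2 <= (L * (t * vnorm u)) ^ 2 by apply: pow_incr; split=> //; apply: vnorm_ge0.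
  have -> : / (2 * / (t * L)) = t * L / 2 by field; lra.
  move=> w2; have : / (t * L) / 2 * vnorm w ^ 2 <= / (t * L) / 2 * (L * (t * vnorm u)) ^ 2.
    by apply: Rmult_le_compat_l => //; lra.
  have -> : / (t * L) / 2 * (L * (t * vnorm u)) ^ 2 = t * L / 2 * vnorm u ^ 2 by field; lra.
  by lra.
pose psi t := f (vadd x (vscale t u)) - dot (g x) u * t - L / 2 * dot u u * t ^ 2.
pose psi' t := G t - dot (g x) u - L / 2 * dot u u * (2 * t).
have psiD t : derivable_pt_lim psi t (psi' t).
  apply: derivable_pt_lim_minus; first apply: derivable_pt_lim_minus.
  - exact: derivable_along_line.
  - rewrite -[X in derivable_pt_lim _ _ X]Rmult_1_r.
    exact: (derivable_pt_lim_scal id _ _ _ (derivable_pt_lim_id t)).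
  - rewrite -[2 * t](_ : INR 2 * t ^ 1 = _); last by rewrite /=; ring.
    exact: (derivable_pt_lim_scal (fun t => t ^ 2) _ _ _ (derivable_pt_lim_pow t 2)).
have [t [psiE [t01 t1]]] := @MVT_cor2 psi psi' 0 1 Rlt_0_1 (fun c _ => psiD c).
have := slope t t01.
have f0 : f (vadd x (vscale 0 u)) = f x /\ f (vadd x (vscale 1 u)) = f y.
  split; apply: f_equal; apply: FunctionalExtensionality.functional_extensionality => j.
    by rewrite /vadd /vscale; ring.
  by rewrite /vadd /vscale /u /vsub; ring.
move: psiE; rewrite /psi /psi' f0.1 f0.2 => psiE sl.
by nra.
Qed.

End Descent.

(** * The proximal step: model decrease, estimator error and variance *)

Lemma le_of_le_add_scaled a c :
  (forall t, 0 < t <= 1 -> a <= t * c) -> a <= 0.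
Proof.
move=> H; apply: Rnot_lt_le => a0.
have c0 : 0 < c by have := H 1; lra.
have t0 : 0 < a / (2 * c) by apply: Rdiv_lt_0_compat; lra.
have ac : a <= c by have := H 1; lra.
have t1 : a / (2 * c) <= 1.
  by apply: (Rmult_le_reg_r (2 * c)); [lra | field_simplify; lra].
have := H _ (conj t0 t1).
have -> : a / (2 * c) * c = a / 2 by field; lra.
by lra.
Qed.

Section ProximalStep.
Variables (d : nat) (domh : vec d -> Prop) (hv : vec d -> R).
Hypothesis h_conv : h_convex domh hv.

(** The prox objective is strongly convex with modulus [/ eta], so its minimizer beats any [z] by a
    quadratic margin in [vsub p z]. *)
Lemma prox_three_point eta x v p z : 0 < eta ->
  is_prox domh hv eta (vsub x (vscale eta v)) p -> domh z ->
  dot v (vsub p x) + hv p + / (2 * eta) * dot (vsub p x) (vsub p x)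
  <= dot v (vsub z x) + hv z + / (2 * eta) * dot (vsub z x) (vsub z x)
     - / (2 * eta) * dot (vsub p z) (vsub p z).
Proof.
move=> eta0 [domp pmin] domz.
(* This is the variational inequality at [p]; expanding the squares turns it into the claim. It
   follows by comparing [p] with the points of the segment to [z] at fraction [t] and letting [t]
   tend to 0. *)
suff : hv p - hv z - / eta * dot (vsub p (vsub x (vscale eta v))) (vsub z p) <= 0.
  rewrite !dotE (dotC z x) (dotC p x) (dotC z p).
  by move=> H; apply: Rminus_le; apply: Rle_trans H; apply: Req_le; field; lra.
apply: (@le_of_le_add_scaled _ (/ (2 * eta) * dot (vsub z p) (vsub z p))) => t [t0 t1].
have [|domy hy] := h_conv (th := t) domz domp; first by lra.
have := pmin _ domy; rewrite !vnorm_sqr /Rdiv.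
set u := vsub x _ => H.
have E (w : vec d) : dot (vsub (vadd (vscale t z) (vscale (1 - t) p)) w)
             (vsub (vadd (vscale t z) (vscale (1 - t) p)) w)
   = dot (vsub p w) (vsub p w) + 2 * t * dot (vsub p w) (vsub z p)
     + t ^ 2 * dot (vsub z p) (vsub z p).
  by rewrite !dotE ?(dotC z w) ?(dotC p w) ?(dotC z p); ring.
rewrite E in H.
have e0 : / (2 * eta) * (2 * eta) = 1 by field; lra.
have -> : / eta = 2 * / (2 * eta) by field; lra.
by apply: (Rmult_le_reg_l t) => //; lra.
Qed.

Variables (n : nat) (f : 'I_n -> vec d -> R) (grad : 'I_n -> vec d -> vec d) (L : R).
Hypothesis n_gt0 : (0 < n)%nat.
Hypothesis L_gt0 : 0 < L.
Hypothesis f_grad : forall i, has_gradient (f i) (grad i).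
Hypothesis grad_lip : forall i, lipschitz_grad L (grad i).

Lemma dot_avg (G : 'I_n -> vec d) x :
  dot (fun j => avg_ord (fun i => G i j)) x = avg_ord (fun i => dot (G i) x).
Proof.
rewrite /dot avg_sum_exchange; apply: eq_bigr => j _.
by rewrite Rmult_comm -avgZ; apply: eq_avg => i; ring.
Qed.

Lemma fsum_descent x y :
  fsum f y <= fsum f x + dot (gradsum grad x) (vsub y x)
              + L / 2 * dot (vsub y x) (vsub y x).
Proof.
rewrite /fsum /gradsum dot_avg -avgD.
rewrite -[X in _ <= _ + X](avg_const n_gt0) -avgD.
by apply: avg_le => // i; apply: descent.
Qed.

Variables (xs : vec d) (mu : R) (prox : R -> vec d -> vec d).
Hypothesis mu_gt0 : 0 < mu.
Hypothesis F_PL : is_PL f grad domh hv xs mu.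
Hypothesis proxP : forall eta x, 0 < eta -> is_prox domh hv eta x (prox eta x).

Local Notation Delta x := (Fobj f hv x - Fobj f hv xs).

(* [prox (1/mu)] applied to a gradient step attains the minimum defining [D_h(x, mu)];
   moving only the fraction [mu * eta] of the way towards it keeps, by convexity,
   the same fraction of the decrease of the model with the larger curvature [1/eta]. *)
Lemma PL_model_decrease eta x : 0 < eta -> mu * eta <= 1 -> domh x ->
  exists2 z, domh z &
    dot (gradsum grad x) (vsub z x) + hv z - hv x
      + / (2 * eta) * dot (vsub z x) (vsub z x) <= - (eta * mu) * Delta x.
Proof.
move=> eta0 mueta domx.
set g := gradsum grad x.
have imu0 : 0 < / mu by apply: Rinv_0_lt_compat.
pose y := prox (/ mu) (vsub x (vscale (/ mu) g)).
have yP : is_prox domh hv (/ mu) (vsub x (vscale (/ mu) g)) y by apply: proxP.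
have domy := yP.1.
pose M := dot g (vsub y x) + mu / 2 * vnorm (vsub y x) ^ 2 + hv y - hv x.
have DM : Dh_is grad domh hv x mu (- 2 * mu * M).
  exists M; split=> //; split; first by exists y.
  move=> w domw; have := prox_three_point imu0 yP domw.
  rewrite /M !vnorm_sqr; have -> : / (2 * / mu) = mu / 2 by field; lra.
  have : 0 <= mu / 2 * dot (vsub y w) (vsub y w).
    by apply: Rmult_le_pos (dot_ge0 _); lra.
  by rewrite -/g; lra.
have PL := F_PL domx DM.
have t01 : 0 <= mu * eta <= 1 by nra.
have [domz hz] := h_conv (th := mu * eta) domy domx t01.
exists (vadd (vscale (mu * eta) y) (vscale (1 - mu * eta) x)) => //.
set z := vadd _ _ in domz hz *.
have gz : dot g (vsub z x) = mu * eta * dot g (vsub y x) by rewrite /z !dotE; ring.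
have zz : dot (vsub z x) (vsub z x) = (mu * eta) ^ 2 * dot (vsub y x) (vsub y x).
  by rewrite /z !dotE (dotC y x); ring.
rewrite gz zz; move: PL; rewrite /M vnorm_sqr => PL.
have {}PL : Delta x <= - (dot g (vsub y x) + mu / 2 * dot (vsub y x) (vsub y x) + hv y - hv x).
  by apply: (Rmult_le_reg_l mu) => //; lra.
have -> : / (2 * eta) * ((mu * eta) ^ 2 * dot (vsub y x) (vsub y x))
  = mu * eta * (mu / 2 * dot (vsub y x) (vsub y x)) by field; lra.
by have := Rmult_le_compat_l (mu * eta) _ _ t01.1 PL; lra.
Qed.

(** Sum of the descent bound at [p], the three-point inequality against [z], the model decrease at
    [z], and Young for the error term paired with [vsub z p]. The Young weight [eta] makes the
    square of [vsub z p] cancel against the margin of the three-point inequality. *)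
Lemma prox_step_decrease eta x v : 0 < eta -> mu * eta <= 1 -> domh x ->
  let p := prox eta (vsub x (vscale eta v)) in
  Delta p <= (1 - eta * mu) * Delta x
    + eta / 2 * dot (vsub v (gradsum grad x)) (vsub v (gradsum grad x))
    - (/ (2 * eta) - L / 2) * dot (vsub p x) (vsub p x).
Proof.
move=> eta0 mueta domx p.
have pP : is_prox domh hv eta (vsub x (vscale eta v)) p by apply: proxP.
have [z domz zdec] := PL_model_decrease eta0 mueta domx.
have := prox_three_point eta0 pP domz.
have := fsum_descent x p.
have := dot_young (vsub v (gradsum grad x)) (vsub z p) eta0.
have -> : dot (vsub z p) (vsub z p) = dot (vsub p z) (vsub p z).
  by rewrite !dotE (dotC z p); ring.
move: zdec; rewrite /Fobj.
have -> : dot (vsub v (gradsum grad x)) (vsub z p)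
  = dot v (vsub z x) - dot v (vsub p x)
   - (dot (gradsum grad x) (vsub z x) - dot (gradsum grad x) (vsub p x)).
  by rewrite !dotE; ring.
by lra.
Qed.

(** One form for both methods: a constant [al] equal to the snapshot gives the SVRG estimator, the
    memory table gives the SAGA one. *)
Definition vr_estimate (b : nat) (I : seq 'I_n) (x : vec d) (al : 'I_n -> vec d) : vec d :=
  vadd (vscale (/ INR b) (vsum_list [seq vsub (grad i x) (grad i (al i)) | i <- I]))
       (fun j => avg_ord (fun i => grad i (al i) j)).

Lemma vsum_listE (I : seq 'I_n) (G : 'I_n -> vec d) j :
  vsum_list [seq G i | i <- I] j = \big[Rplus/0]_(i <- I) G i j.
Proof. by elim: I => [|i I IH]; rewrite ?big_nil ?big_cons //= /vadd IH. Qed.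

(** In each coordinate the error is a sample mean minus its expectation, so the scalar bound
    applies; summing the coordinates back gives squared gradient differences, which the Lipschitz
    condition controls. *)
Lemma vr_variance b x al : (0 < b)%nat ->
  Eseq b (fun I => dot (vsub (vr_estimate b I x al) (gradsum grad x))
                       (vsub (vr_estimate b I x al) (gradsum grad x)))
  <= L ^ 2 / INR b * avg_ord (fun i => dot (vsub x (al i)) (vsub x (al i))).
Proof.
move=> b_gt0; have b0 := INR_gt0 b_gt0.
pose ze (j : 'I_d) i := vsub (grad i x) (grad i (al i)) j.
have -> : Eseq b (fun I => dot (vsub (vr_estimate b I x al) (gradsum grad x))
                       (vsub (vr_estimate b I x al) (gradsum grad x)))
  = \big[Rplus/0]_(j < d) Eseq b (fun I =>
     (/ INR b * (\big[Rplus/0]_(i <- I) ze j i) - avg_ord (ze j)) ^ 2).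
  rewrite -Eseq_sum_exchange; apply: eq_Eseq => I _.
  apply: eq_bigr => j _; rewrite /vsub /vr_estimate /vadd /vscale vsum_listE.
  have -> : avg_ord (ze j) = gradsum grad x j - avg_ord (fun i => grad i (al i) j).
    have : avg_ord (fun i => ze j i + grad i (al i) j) = gradsum grad x j.
      by apply: eq_avg => i; rewrite /ze /vsub; ring.
    by rewrite avgD; lra.
  by rewrite /ze /vsub; ring.
apply: (Rle_trans _ (\big[Rplus/0]_(j < d) (/ INR b * avg_ord (fun i => ze j i ^ 2)))).
  by apply: sumR_le => j; apply: Eseq_mean_sqr_le.
rewrite -big_distrr -avg_sum_exchange /=.
have -> : L ^ 2 / INR b * avg_ord (fun i => dot (vsub x (al i)) (vsub x (al i)))
  = / INR b * avg_ord (fun i => L ^ 2 * dot (vsub x (al i)) (vsub x (al i))).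
  by rewrite avgZ; field; lra.
apply: Rmult_le_compat_l; first exact/Rlt_le/Rinv_0_lt_compat.
apply: avg_le => // i.
have -> : \big[Rplus/0]_(j < d) (ze j i * (ze j i * 1))
    = vnorm (vsub (grad i x) (grad i (al i))) ^ 2.
  by rewrite vnorm_sqr; apply: eq_bigr => j _; rewrite /ze; ring.
rewrite -vnorm_sqr -Rpow_mult_distr.
by apply: pow_incr; split; [apply: vnorm_ge0 | apply: grad_lip].
Qed.

End ProximalStep.

(** * Estimates common to both algorithms at step size [/ (5 * L)] *)

Lemma dist_young d t (p x y : vec d) : 0 < t ->
  dot (vsub p y) (vsub p y)
  <= (1 + / t) * dot (vsub p x) (vsub p x) + (1 + t) * dot (vsub x y) (vsub x y).
Proof.
move=> t0; have -> : dot (vsub p y) (vsub p y)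
    = dot (vadd (vsub p x) (vsub x y)) (vadd (vsub p x) (vsub x y)).
  by rewrite !dotE (dotC x p) (dotC y p) (dotC y x); ring.
exact: dot_add_young.
Qed.

Lemma avg_nth (T : Type) (k : nat) (x0 : T) (l : seq T) (G : T -> R) :
  size l = k ->
  avg_ord (fun i : 'I_k => G (nth x0 l i)) = / INR k * \big[Rplus/0]_(y <- l) G y.
Proof. by move=> <-; rewrite /avg_ord (big_nth x0) big_mkord. Qed.

Lemma take_drop_cat (T : Type) (u w : seq T) k :
  size u = k -> take k (u ++ w) = u /\ drop k (u ++ w) = w.
Proof. by move=> su; rewrite take_size_cat // drop_size_cat. Qed.

Section Algorithms.
Variables (n d : nat) (f : 'I_n -> vec d -> R) (grad : 'I_n -> vec d -> vec d) (L : R).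
Variables (domh : vec d -> Prop) (hv : vec d -> R) (xs : vec d) (mu : R).
Variables (prox : R -> vec d -> vec d).
Hypothesis n_gt0 : (0 < n)%nat.
Hypothesis L_gt0 : 0 < L.
Hypothesis f_grad : forall i, has_gradient (f i) (grad i).
Hypothesis grad_lip : forall i, lipschitz_grad L (grad i).
Hypothesis h_conv : h_convex domh hv.
Hypothesis xs_min : forall y, domh y -> Fobj f hv xs <= Fobj f hv y.
Hypothesis mu_gt0 : 0 < mu.
Hypothesis mu_le : mu <= 5 * L.
Hypothesis F_PL : is_PL f grad domh hv xs mu.
Hypothesis proxP : forall eta x, 0 < eta -> is_prox domh hv eta x (prox eta x).

Local Notation Delta x := (Fobj f hv x - Fobj f hv xs).
Local Notation eta := (/ (5 * L)).
Local Notation sqd x y := (dot (vsub x y) (vsub x y)).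

Lemma eta_gt0 : 0 < eta.
Proof. by apply: Rinv_0_lt_compat; lra. Qed.

Lemma prox_dom x : domh (prox eta x).
Proof. exact: (proxP x eta_gt0).1. Qed.

Lemma vr_step_decrease b I x al : domh x ->
  let v := vr_estimate grad b I x al in
  let p := prox eta (vsub x (vscale eta v)) in
  Delta p <= (1 - eta * mu) * Delta x
    + / (10 * L) * sqd v (gradsum grad x) - 2 * L * sqd p x.
Proof.
move=> domx v p.
have mueta : mu * eta <= 1.
  apply: (Rmult_le_reg_r (5 * L)); first by lra.
  by field_simplify; lra.
have := prox_step_decrease h_conv n_gt0 L_gt0 f_grad grad_lip mu_gt0 F_PL proxP v
  eta_gt0 mueta domx.
rewrite -/p.
have -> : eta / 2 = / (10 * L) by field; lra.
by have -> : / (2 * eta) - L / 2 = 2 * L by field; lra.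
Qed.

Lemma vr_variance_scaled b x al : (0 < b)%nat ->
  / (10 * L) * Eseq b (fun I => sqd (vr_estimate grad b I x al) (gradsum grad x))
  <= L / (10 * INR b) * avg_ord (fun i => sqd x (al i)).
Proof.
move=> b_gt0; have b0 := INR_gt0 b_gt0.
have -> : L / (10 * INR b) * avg_ord (fun i => sqd x (al i))
  = / (10 * L) * (L ^ 2 / INR b * avg_ord (fun i => sqd x (al i))) by field; lra.
apply: Rmult_le_compat_l; first by apply/Rlt_le/Rinv_0_lt_compat; lra.
exact: vr_variance.
Qed.

(** [G] stands for the expected outcome of later stages, which is controlled only on [domh]; the
    iterates stay there because every prox value lies in [domh]. *)
Variable G : vec d -> R.
Hypothesis G_le : forall y, domh y -> G y <= Delta y.

(** * One stage of ProxSVRG *)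

Section SVRG.
Variables b m : nat.
Hypothesis b_gt0 : (0 < b)%nat.
Hypothesis m_gt0 : (0 < m)%nat.
Hypothesis m2_le_b : INR m ^ 2 <= INR b.

(* The Lyapunov function is [Delta x + (L / b) (r / 5) |x - xt|^2], with [r] inner iterations
   left.  [V] stands for whatever is computed from the last inner iterate and the unused draws,
   which lets consecutive epochs be chained. *)
Lemma svrg_inner_decrease r N (V : vec d -> seq 'I_n -> R) xt x :
  (r <= m)%nat -> domh x -> (forall y, domh y -> Eseq N (V y) <= Delta y) ->
  Eseq (r * b + N) (fun w =>
    let: (l, xl, w') := svrg_inner grad prox b r eta xt (gradsum grad xt) x w in
    eta * mu * \big[Rplus/0]_(y <- l) G y + V xl w')
  <= Delta x + L / INR b * (INR r / 5) * sqd x xt.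
Proof.
move=> + + V_le; elim: r x => [|r IH] x r_le domx.
  have -> : Delta x + L / INR b * (INR 0 / 5) * sqd x xt = Delta x.
    by rewrite /=; field; have := INR_gt0 b_gt0; lra.
  apply: Rle_trans (V_le x domx); apply: Req_le; apply: eq_Eseq => w _ /=.
  by rewrite big_nil; ring.
rewrite mulSn -addnA Eseq_cat.
have b0 := INR_gt0 b_gt0; have m0 := INR_gt0 m_gt0.
have rm : INR r + 1 <= INR m by rewrite -S_INR; apply: le_INR; apply/leP.
have m1 : 1 <= INR m by have := pos_INR r; lra.
pose est I := vr_estimate grad b I x (fun _ => xt).
apply: (Rle_trans _ (Eseq b (fun I =>
   (Delta x + (L / INR b * (INR r / 5) * (1 + / (2 * INR m))) * sqd x xt)
     + / (10 * L) * sqd (est I) (gradsum grad x)))).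
  apply: Eseq_le => // u su.
  pose p := prox eta (vsub x (vscale eta (est u))).
  apply: (Rle_trans _ (eta * mu * G x + 1 * (Delta p + L / INR b * (INR r / 5) * sqd p xt))).
    apply: Rle_trans (_ : _ <= eta * mu * G x + 1 * _) _; last first.
      apply/Rplus_le_compat_l/Rmult_le_compat_l; first by lra.
      by apply: (IH p); [apply: ltnW | apply: prox_dom].
    rewrite -Eseq_affine //; apply: Req_le; apply: eq_Eseq => w _ /=.
    have [-> ->] := take_drop_cat w su.
    rewrite -/(est u) -/p; case: (svrg_inner _ _ _ _ _ _ _ _ _) => [[l xl] w'].
    by rewrite big_cons; ring.
  have step := vr_step_decrease b u (fun _ => xt) domx.
  cbv zeta in step; rewrite -/(est u) -/p in step.
  (* This Young weight inflates the distance to the snapshot only by [1 + / (2 * INR m)], harmless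
     over [m] iterations; the price [1 + 2 * INR m] on the step length is paid in [cm], thanks to
     [INR m ^ 2 <= INR b]. *)
  have bet : 0 < / (2 * INR m) by apply: Rinv_0_lt_compat; lra.
  have yng := dist_young p x xt bet; rewrite Rinv_inv in yng.
  have c0 : 0 <= L / INR b * (INR r / 5).
    apply: Rmult_le_pos; first by apply/Rlt_le/Rdiv_lt_0_compat.
    by have := pos_INR r; lra.
  have cm : L / INR b * (INR r / 5) * (1 + 2 * INR m) <= 2 * L.
    have -> : L / INR b * (INR r / 5) * (1 + 2 * INR m)
      = L * (/ INR b * (INR r * (1 + 2 * INR m) / 5)) by field; lra.
    have : / INR b * (INR r * (1 + 2 * INR m) / 5) <= 2.
      apply: (Rmult_le_reg_l (INR b)) => //.
      rewrite -Rmult_assoc Rinv_r; last by lra.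
      by have := pos_INR r; nra.
    by nra.
  have em0 : 0 <= eta * mu by have := eta_gt0; nra.
  have gx := Rmult_le_compat_l _ _ _ em0 (G_le domx).
  have yc := Rmult_le_compat_l _ _ _ c0 yng.
  have dc := Rmult_le_compat_r _ _ _ (dot_ge0 (vsub p x)) cm.
  by lra.
rewrite Eseq_affine //.
have := vr_variance_scaled x (fun _ => xt) b_gt0; rewrite -/est avg_const // => var.
(* One iteration may raise the weight by [/ 5] (times [L / INR b]): Young takes
   [INR r / INR m / 10], at most [/ 10], and the variance takes the other [/ 10]. *)
suff : L / INR b * (INR r / 5) * (1 + / (2 * INR m)) + L / (10 * INR b)
       <= L / INR b * (INR r.+1 / 5).
  by move/(Rmult_le_compat_r _ _ _ (dot_ge0 (vsub x xt))); rewrite /est; lra.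
rewrite S_INR.
have -> : L / INR b * (INR r / 5) * (1 + / (2 * INR m)) + L / (10 * INR b)
  = L / INR b * (INR r / 5 + / 10 * (INR r / INR m) + / 10) by field; lra.
apply: Rmult_le_compat_l; first by apply/Rlt_le/Rdiv_lt_0_compat.
have : INR r / INR m <= 1.
  by apply: (Rmult_le_reg_r (INR m)) => //; field_simplify; lra.
by lra.
Qed.

(** Epochs chain with the remaining epochs in the role of [V]. Each starts at its own snapshot, so
    its initial distance term vanishes. *)
Lemma svrg_outer_decrease s x : domh x ->
  Eseq (s * m * b) (fun w =>
    eta * mu * \big[Rplus/0]_(y <- svrg_outer grad prox b m s eta x w) G y) <= Delta x.
Proof.
elim: s x => [|s IH] x domx /=.
  by rewrite big_nil; have := xs_min domx; lra.
rewrite mulSn mulnDl.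
have -> : Delta x = Delta x + L / INR b * (INR m / 5) * sqd x x.
  have -> : sqd x x = 0 by rewrite !dotE; ring.
  by ring.
apply: Rle_trans (svrg_inner_decrease x (leqnn m) domx IH).
apply: Req_le; apply: eq_Eseq => w _.
case: (svrg_inner _ _ _ _ _ _ _ _ _) => [[l xl] w'].
by rewrite big_cat /=; ring.
Qed.

Lemma size_svrg_inner r xt g x w :
  size (svrg_inner grad prox b r eta xt g x w).1.1 = r.
Proof.
elim: r x w => [|r IH] x w //=.
by move: (IH (prox eta (vsub x (vscale eta (vr_est grad b (take b w) x xt g)))) (drop b w));
  case: (svrg_inner _ _ _ _ _ _ _ _ _) => [[l xl] w'] /= ->.
Qed.

Lemma size_svrg_outer s x w : size (svrg_outer grad prox b m s eta x w) = (s * m)%nat.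
Proof.
elim: s x w => [|s IH] x w //=.
move: (size_svrg_inner m x (gradsum grad x) x w).
by case: (svrg_inner _ _ _ _ _ _ _ _ _) => [[l xl] w'] /= sl; rewrite size_cat sl IH.
Qed.

Lemma le_ceil_div_mul T : (T <= ceil_div T m * m)%nat.
Proof.
rewrite /ceil_div; have m0 : m <> 0%nat by apply/eqP; rewrite -lt0n.
have := PeanoNat.Nat.mod_upper_bound (T + m - 1) m m0.
have := PeanoNat.Nat.div_mod_eq (T + m - 1) m.
set q := Nat.div _ _; set r := Nat.modulo _ _ => E /ltP r_lt.
have {}E : (T + m - 1 = m * q + r)%nat by [].
rewrite mulnC -(leq_add2r m) -ltnS.
have : (T + m <= (T + m - 1).+1)%nat by rewrite subn1 leqSpred.
move=> H; apply: leq_ltn_trans H _.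
by rewrite E ltnS -addnS leq_add2l.
Qed.

Lemma E_ProxSVRG_le T x : 0 < INR T -> domh x ->
  E_ProxSVRG grad prox T m b eta x G <= 5 * L / (mu * INR T) * Delta x.
Proof.
move=> T0 domx; rewrite /E_ProxSVRG; set S := ceil_div T m.
(* The output averages over [S * m] iterates, at least [T] of them, so the rate in [S * m] is no
   worse than the one in [T]. *)
have ST : INR T <= INR (S * m) by apply: le_INR; apply/leP; apply: le_ceil_div_mul.
have D0 : 0 <= Delta x by have := xs_min domx; lra.
rewrite (@eq_Eseq _ _ _ (fun w => (5 * L / (mu * INR (S * m))) *
   (eta * mu * \big[Rplus/0]_(y <- svrg_outer grad prox b m S eta x w) G y))).
  rewrite EseqZ; apply: Rle_trans (_ : _ <= 5 * L / (mu * INR (S * m)) * Delta x) _.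
    apply: Rmult_le_compat_l; last exact: svrg_outer_decrease.
    by apply/Rlt_le/Rdiv_lt_0_compat; nra.
  apply: Rmult_le_compat_r => //; apply: Rmult_le_compat_l; first by lra.
  by apply: Rinv_le_contravar; nra.
move=> w _; rewrite avg_nth ?size_svrg_outer //.
by field; split; nra.
Qed.

End SVRG.

(** * One stage of ProxSAGA *)

(* In the application [q = b / (2 n)], a lower bound for the probability that a given index
   is refreshed in one iteration, and [c = L / (5 b q)]. *)
Section SAGA.
Variables (b : nat) (q c : R).
Hypothesis b_gt0 : (0 < b)%nat.
Hypothesis q_gt0 : 0 < q.
Hypothesis miss_le : (1 - / INR n) ^ b <= 1 - q.
Hypothesis c_var : L / (10 * INR b) <= c * q / 2.
Hypothesis c_step : c * (1 + 2 / q) <= 2 * L.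

Local Notation A x al := (avg_ord (fun i => sqd x (al i))).

Lemma c_ge0 : 0 <= c.
Proof.
have b0 := INR_gt0 b_gt0.
have : 0 < L / (10 * INR b) by apply: Rdiv_lt_0_compat; lra.
by nra.
Qed.

(** A stored point becomes [x] unless missed, with probability [rho <= 1 - q]. For a missed point,
    Young with weight [q / 2] applies, and [(1 - q) * (1 + q / 2) <= 1 - q / 2] gives the
    contraction. *)
Lemma saga_memory_step (p x : vec d) (al : 'I_n -> vec d) :
  Eseq b (fun J => A p (fun j => if j \in J then x else al j))
  <= (1 + 2 / q) * sqd p x + (1 - q / 2) * A x al.
Proof.
rewrite (@eq_Eseq _ _ _ (fun J : seq 'I_n =>
    avg_ord (fun i => if i \in J then sqd p x else sqd p (al i)))); last first.
  by move=> J _; apply: eq_avg => i; case: ifP.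
rewrite Eseq_avg_exchange // -[X in _ <= X + _](avg_const n_gt0) -avgZ -avgD.
apply: avg_le => // i; rewrite Eseq_mem //.
set rho := _ ^ b; have rho0 : 0 <= rho.
  apply: pow_le; have n1 : 1 <= INR n by rewrite -[1]/(INR 1); apply: le_INR; apply/leP.
  have : / INR n <= / 1 by apply: Rinv_le_contravar; lra.
  by rewrite Rinv_1; lra.
have yng := @dist_young d (q / 2) p x (al i) ltac:(lra).
have -> : 2 / q = / (q / 2) by field; lra.
have iq : 0 < / (q / 2) by apply: Rinv_0_lt_compat; lra.
have s0 := dot_ge0 (vsub p x); have t0 := dot_ge0 (vsub x (al i)).
have := Rmult_le_compat_l _ _ _ rho0 yng.
have mr : rho <= 1 - q := miss_le.
have : rho * (1 + q / 2) <= 1 - q / 2 by nra.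
move=> /(Rmult_le_compat_r _ _ _ t0) H1 H2.
have H3 : rho * (/ (q / 2) * sqd p x) <= / (q / 2) * sqd p x.
  rewrite -[X in _ <= X]Rmult_1_l; apply: Rmult_le_compat_r; last by lra.
  by apply: Rmult_le_pos => //; apply: Rlt_le.
by lra.
Qed.

(** The weight [c] stays constant: the contraction of the memory term frees [c * q / 2], which pays
    for the variance by [c_var], while [c_step] absorbs the rest into the step-length term. *)
Lemma saga_run_decrease r x al : domh x ->
  Eseq (r * (b + b)) (fun w =>
    eta * mu * \big[Rplus/0]_(y <- saga_run grad prox b r eta x al w) G y)
  <= Delta x + c * A x al.
Proof.
elim: r x al => [|r IH] x al domx.
  rewrite /= big_nil.
  have : 0 <= A x al by apply: avg_ge0 => // i; apply: dot_ge0.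
  by have := c_ge0; have := xs_min domx; nra.
rewrite mulSn -addnA Eseq_cat.
have A0 : 0 <= A x al by apply: avg_ge0 => // i; apply: dot_ge0.
pose est I := vr_estimate grad b I x al.
apply: (Rle_trans _ (Eseq b (fun I =>
   (Delta x + c * (1 - q / 2) * A x al) + / (10 * L) * sqd (est I) (gradsum grad x)))).
  apply: Eseq_le => // I sI; rewrite Eseq_cat.
  (* [p] depends on [I] alone, so with [I] fixed the refresh set [J] is averaged first, and only
     then the estimator over [I]. *)
  pose p := prox eta (vsub x (vscale eta (est I))).
  apply: (Rle_trans _ (Eseq b (fun J => (eta * mu * G x + Delta p) +
       c * A p (fun j => if j \in J then x else al j)))).
    apply: Eseq_le => // J sJ.
    apply: Rle_trans (_ : _ <= eta * mu * G x + 1 * _) _; last first.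
      rewrite Rplus_assoc; apply/Rplus_le_compat_l; rewrite Rmult_1_l.
      by apply: IH; apply: prox_dom.
    rewrite -Eseq_affine //; apply: Req_le; apply: eq_Eseq => w _ /=.
    have [-> ->] := take_drop_cat (J ++ w) sI.
    have [-> _] := take_drop_cat w sJ.
    rewrite -[vadd (vscale _ _) _]/(est I) -/p catA drop_size_cat ?size_cat ?sI ?sJ //.
    by rewrite big_cons; ring.
  rewrite Eseq_affine //.
  have step := vr_step_decrease b I al domx.
  cbv zeta in step; rewrite -/(est I) -/p in step.
  have em0 : 0 <= eta * mu by have := eta_gt0; nra.
  have gx := Rmult_le_compat_l _ _ _ em0 (G_le domx).
  have mem := Rmult_le_compat_l _ _ _ c_ge0 (saga_memory_step p x al).
  have dc := Rmult_le_compat_r _ _ _ (dot_ge0 (vsub p x)) c_step.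
  by lra.
rewrite Eseq_affine //.
have := vr_variance_scaled x al b_gt0; rewrite -/est.
have := Rmult_le_compat_r _ _ _ A0 c_var.
by rewrite /est; lra.
Qed.

Lemma size_saga_run r x al w : size (saga_run grad prox b r eta x al w) = r.
Proof. by elim: r x al w => [|r IH] x al w //=; rewrite IH. Qed.

Lemma E_ProxSAGA_le T x : 0 < INR T -> domh x ->
  E_ProxSAGA grad prox T b eta x G <= 5 * L / (mu * INR T) * Delta x.
Proof.
move=> T0 domx; rewrite /E_ProxSAGA.
rewrite (@eq_Eseq _ _ _ (fun w => (5 * L / (mu * INR T)) *
   (eta * mu * \big[Rplus/0]_(y <- saga_run grad prox b T eta x (fun _ => x) w) G y))).
  rewrite EseqZ; apply: Rmult_le_compat_l.
    by apply/Rlt_le/Rdiv_lt_0_compat; nra.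
  apply: Rle_trans (saga_run_decrease _ _ domx) _.
  rewrite avg_const //; have -> : sqd x x = 0 by rewrite !dotE; ring.
  by lra.
move=> w _; rewrite avg_nth ?size_saga_run //.
by field; split; nra.
Qed.

End SAGA.
End Algorithms.

(** * Restarting: composition of the stages *)

Lemma E_ProxSVRG_scale n d (grad : 'I_n -> vec d -> vec d) prox T m b eta x a G :
  E_ProxSVRG grad prox T m b eta x (fun y => a * G y)
  = a * E_ProxSVRG grad prox T m b eta x G.
Proof. by rewrite /E_ProxSVRG -EseqZ; apply: eq_Eseq => w _; rewrite avgZ. Qed.

Lemma E_ProxSAGA_scale n d (grad : 'I_n -> vec d -> vec d) prox T b eta x a G :
  E_ProxSAGA grad prox T b eta x (fun y => a * G y)
  = a * E_ProxSAGA grad prox T b eta x G.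
Proof. by rewrite /E_ProxSAGA -EseqZ; apply: eq_Eseq => w _; rewrite avgZ. Qed.

(** By induction the remaining [K] stages have expected value at most [D y / 2 ^ K] from [y].
    Multiplied by [2 ^ K] this function is dominated by [D], so the one-stage bound applies to it,
    and homogeneity removes the factor. *)
Lemma iterE_halving d (E : vec d -> (vec d -> R) -> R) (dom : vec d -> Prop) (D : vec d -> R) :
  (forall x a G, E x (fun y => a * G y) = a * E x G) ->
  (forall x G, dom x -> (forall y, dom y -> G y <= D y) -> E x G <= D x / 2) ->
  forall K x, dom x -> iterE E K x D <= D x / 2 ^ K.
Proof.
move=> scaleE halfE; elim=> [|K IH] x domx /=; first by lra.
have K0 : 0 < 2 ^ K by apply: pow_lt; lra.
have := halfE x (fun y => 2 ^ K * iterE E K y D) domx.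
rewrite scaleE => H; apply: (Rmult_le_reg_l (2 ^ K)) => //.
have -> : 2 ^ K * (D x / (2 * 2 ^ K)) = D x / 2 by field; lra.
apply: H => y domy; have := Rmult_le_compat_l _ _ _ (Rlt_le _ _ K0) (IH y domy).
by have -> : 2 ^ K * (D y / 2 ^ K) = D y by field; lra.
Qed.

(** * Choice of parameters and conclusion *)

Lemma pow_one_sub_mul_le1 u k : 0 <= u <= 1 -> (1 - u) ^ k * (1 + INR k * u) <= 1.
Proof.
move=> [u0 u1]; elim: k => [|k IH]; first by rewrite /=; lra.
have k0 := pos_INR k.
apply: Rle_trans IH; rewrite S_INR -tech_pow_Rmult Rmult_comm -Rmult_assoc.
rewrite Rmult_comm; apply: Rmult_le_compat_l; first by apply: pow_le; lra.
by have := Rmult_le_pos _ _ k0 (Rmult_le_pos _ _ u0 u0); nra.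
Qed.

(** With [s = / a], the ratio of [b] to [n], the miss probability is at most [/ (1 + s)], and
    [1 <= (1 - s / 2) * (1 + s)] for [s] in [0, 1]. *)
Lemma miss_prob_le n b a : 1 <= a -> INR n = a ^ 3 -> INR b = a ^ 2 ->
  (1 - / INR n) ^ b <= 1 - / (2 * a).
Proof.
move=> a1 nE bE.
have n1 : 1 <= INR n by rewrite nE; apply: pow_R1_Rle.
have u01 : 0 <= / INR n <= 1.
  split; first by apply/Rlt_le/Rinv_0_lt_compat; lra.
  by rewrite -Rinv_1; apply: Rinv_le_contravar; lra.
have := pow_one_sub_mul_le1 b u01.
have -> : INR b * / INR n = / a by rewrite bE nE; field; lra.
set rho := _ ^ b => H.
have s0 : 0 < / a by apply: Rinv_0_lt_compat; lra.
have s1 : / a <= 1 by rewrite -Rinv_1; apply: Rinv_le_contravar; lra.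
have -> : / (2 * a) = / a / 2 by field; lra.
apply: (Rmult_le_reg_r (1 + / a)); first by lra.
by nra.
Qed.

Unset Implicit Arguments.

Theorem theorem7
  (n d : nat) (Hn : (1 <= n)%nat) (Hd : (1 <= d)%nat)
  (f : 'I_n -> vec d -> R) (grad : 'I_n -> vec d -> vec d) (L : R)
  (HL : 0 < L)
  (Hgrad : forall i, has_gradient (f i) (grad i))
  (Hsmooth : forall i, lipschitz_grad L (grad i))
  (domh : vec d -> Prop) (hv : vec d -> R)
  (Hproper : h_proper domh) (Hconv : h_convex domh hv) (Hlsc : h_lsc domh hv)
  (Hclosed : closed_vset domh)
  (prox : R -> vec d -> vec d)
  (Hprox : forall eta x, 0 < eta -> is_prox domh hv eta x (prox eta x))
  (xs : vec d) (Hxs_dom : domh xs)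
  (Hxs_min : forall y, domh y -> Fobj f hv xs <= Fobj f hv y)
  (mu : R) (Hmu : 0 < mu) (HPL : is_PL f grad domh hv xs mu)
  (Hkappa : Rpower (INR n) (/ 3) < L / mu)
  (b m T : nat)
  (Hb : INR b = Rpower (INR n) (2 / 3))
  (Hm : INR m <= Rpower (INR n) (/ 3) < INR m + 1)
  (HT : INR T - 1 < 30 * (L / mu) <= INR T)
  (x0 : vec d) (Hx0 : domh x0) :
  let eta := / (5 * L) in
  forall K : nat, (1 <= K)%nat ->
    iterE (fun x G => E_ProxSVRG grad prox T m b eta x G) K x0
          (fun y => Fobj f hv y - Fobj f hv xs)
      <= (Fobj f hv x0 - Fobj f hv xs) / 2 ^ K
    /\
    iterE (fun x G => E_ProxSAGA grad prox T b eta x G) K x0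
          (fun y => Fobj f hv y - Fobj f hv xs)
      <= (Fobj f hv x0 - Fobj f hv xs) / 2 ^ K.
Proof.
move=> eta K _.
(* All parameters are expressed through [a]: [INR n = a ^ 3], [INR b = a ^ 2], and [INR m <= a]. *)
pose a := Rpower (INR n) (/ 3).
have n1 : 1 <= INR n by rewrite -[1]/(INR 1); apply: le_INR; apply/leP.
have a0 : 0 < a by apply: exp_pos.
have nE : INR n = a ^ 3.
  rewrite -Rpower_pow // /a Rpower_mult.
  have -> : / 3 * INR 3 = 1 by rewrite /=; field.
  by rewrite Rpower_1 //; lra.
have bE : INR b = a ^ 2.
  by rewrite Hb -Rpower_pow // /a Rpower_mult; congr Rpower; rewrite /=; field.
have a1 : 1 <= a.
  apply: Rnot_lt_le => alt; have : a ^ 3 < 1 by rewrite /=; nra.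
  by rewrite -nE; lra.
have Lmu : L = L / mu * mu by field; lra.
have muL : mu <= 5 * L by move: Hkappa; rewrite -/a; nra.
have b_gt0 : (0 < b)%nat by apply/ltP; apply: INR_lt; rewrite bE /=; nra.
have m_gt0 : (0 < m)%nat.
  by apply/ltP; apply: INR_lt; move: Hm; rewrite -/a /=; lra.
have m2b : INR m ^ 2 <= INR b.
  by rewrite bE; apply: pow_incr; split; [apply: pos_INR | apply: Hm.1].
have T0 : 0 < INR T by move: Hkappa; rewrite -/a; lra.
have rate x : domh x ->
    5 * L / (mu * INR T) * (Fobj f hv x - Fobj f hv xs) <= (Fobj f hv x - Fobj f hv xs) / 2.
  move=> domx; have := Hxs_min x domx => D0.
  (* [T] is at least [30 * (L / mu)], so the left side is in fact at most 1/6. *)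
  suff : 5 * L / (mu * INR T) <= / 2 by nra.
  apply: (Rmult_le_reg_r (mu * INR T)); first by nra.
  have -> : 5 * L / (mu * INR T) * (mu * INR T) = 5 * L by field; lra.
  by nra.
split; apply: (iterE_halving (dom := domh)) => // x G.
- by move=> c; apply: E_ProxSVRG_scale.
- move=> domx G_le; apply: Rle_trans (rate x domx).
  exact: (E_ProxSVRG_le Hn HL Hgrad Hsmooth Hconv Hxs_min Hmu muL HPL Hprox G_le).
- by move=> c; apply: E_ProxSAGA_scale.
- move=> domx G_le; apply: Rle_trans (rate x domx).
  have ia0 : 0 < / a by apply: Rinv_0_lt_compat.
  have ia1 : / a <= 1 by rewrite -Rinv_1; apply: Rinv_le_contravar; lra.
  (* This [c] makes the variance condition an equality; the step condition reads
     [2 / 5 * L * (/ a + 4) <= 2 * L], which holds because [/ a <= 1]. *)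
  apply: (E_ProxSAGA_le Hn HL Hgrad Hsmooth Hconv Hxs_min Hmu muL HPL Hprox G_le
    (q := / (2 * a)) (c := 2 * L / (5 * a))) => //.
  + by apply: Rinv_0_lt_compat; lra.
  + exact: miss_prob_le.
  + by rewrite bE; apply: Req_le; field; lra.
  + have -> : 2 * L / (5 * a) * (1 + 2 / / (2 * a)) = 2 / 5 * L * (/ a + 4) by field; lra.
    by have := Rmult_le_compat_l L _ _ (Rlt_le _ _ HL) ia1; lra.
Qed.
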